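(* Let $\mathcal{H}$ be a separable right quaternionic Hilbert space and let $T\in\mathcal{B}(\mathcal{H})$ be a complex operator with respect to an orthonormal basis $\mathcal{E}$ of $\mathcal{H}$, with $\mathbb{C}$-spectrum $\sigma_{\mathbb{C}}(T)$ (taken with respect to $\mathcal{E}$). Then $$\sigma_S(T)=[\sigma_{\mathbb{C}}(T)],\qquad\text{where } [\sigma_{\mathbb{C}}(T)]=\bigcup_{\lambda\in\sigma_{\mathbb{C}}(T)}[\lambda].$$
   Context: $\mathbb{H}$ denotes the real quaternions with basis $\{1,i,j,k\}$, and $\mathbb{C}=\mathrm{span}_{\mathbb{R}}\{1,i\}\subset\mathbb{H}$. For $q\in\mathbb{H}$, $[q]=\{s^*qs: s\in\mathbb{H},|s|=1\}$ is its similarity class. $\mathcal{H}$ is a right quaternionic Hilbert space with inner product $\langle\cdot,\cdot\rangle$ that is right $\mathbb{H}$-linear in the first variable, satisfies $\langle x,y\rangle=\langle y,x\rangle^*$ and is positive definite; $\mathcal{H}$ is separable, with countable orthonormal bases indexed by $\mathbb{N}$. $\mathcal{B}(\mathcal{H})$ is the set of bounded right $\mathbb{H}$-linear operators on $\mathcal{H}$. For $q\in\mathbb{H}$ put $\Delta_q(T)=T^2-2\,\mathrm{Re}(q)\,T+|q|^2 I$; the S-spectrum is $\sigma_S(T)=\{q\in\mathbb{H}:\Delta_q(T)\text{ is not invertible in }\mathcal{B}(\mathcal{H})\}$. An operator $T\in\mathcal{B}(\mathcal{H})$ is a complex operator if there is an orthonormal basis $\mathcal{E}=\{e_n:n\in\mathbb{N}\}$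 of $\mathcal{H}$ with $\langle Te_n,e_m\rangle\in\mathbb{C}$ for all $n,m\in\mathbb{N}$. Let $\mathcal{H}_{\mathbb{C}}=\overline{\mathrm{span}_{\mathbb{C}}\,\mathcal{E}}$ be the right complex Hilbert space with orthonormal basis $\mathcal{E}$ (with the restricted inner product, which is $\mathbb{C}$-valued on it). Then $\mathcal{H}=\mathcal{H}_{\mathbb{C}}\oplus\mathcal{H}_{\mathbb{C}}j$ as real spaces, $T(\mathcal{H}_{\mathbb{C}})\subseteq\mathcal{H}_{\mathbb{C}}$, and $T_{|}:\mathcal{H}_{\mathbb{C}}\to\mathcal{H}_{\mathbb{C}}$ denotes the restriction, a bounded right $\mathbb{C}$-linear operator. With $(I_{\mathcal{H}_{\mathbb{C}}}\cdot\lambda)(x)=x\lambda$ for $x\in\mathcal{H}_{\mathbb{C}}$, $\lambda\in\mathbb{C}$, the $\mathbb{C}$-spectrum of $T$ is $\sigma_{\mathbb{C}}(T)=\{\lambda\in\mathbb{C}: T_{|}-I_{\mathcal{H}_{\mathbb{C}}}\cdot\lambda\text{ is not invertible in }\mathcal{B}(\mathcal{H}_{\mathbb{C}})\}$, where $\mathcal{B}(\mathcal{H}_{\mathbb{C}})$ is the set of bounded right $\mathbb{C}$-linear operators on $\mathcal{H}_{\mathbb{C}}$. *)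

(* Defs.v *)
From HB Require Import structures.
From mathcomp Require Import all_boot all_order all_algebra.
From mathcomp Require Import all_classical all_reals all_analysis.
From mathcomp Require Import ring.

Set Implicit Arguments.
Unset Strict Implicit.
Unset Printing Implicit Defensive.

Import Order.TTheory GRing.Theory Num.Theory.
Import numFieldNormedType.Exports.

Local Open Scope classical_set_scope.
Local Open Scope ring_scope.

(* [Quat a b c d] is the quaternion a + b i + c j + d k. *)
Record quat (R : Type) : Type :=
  Quat { qre : R; qi : R; qj : R; qk : R }.

Section QuatRing.
Variable R : realType.
Local Notation quat := (quat R).

Lemma quatP (p q : quat) :
  qre p = qre q -> qi p = qi q -> qj p = qj q -> qk p = qk q -> p = q.
Proof. by case: p q => ? ? ? ? [? ? ? ?] /= -> -> -> ->. Qed.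

Definition tuple_of_quat (q : quat) := (qre q, qi q, qj q, qk q).
Definition quat_of_tuple (t : R * R * R * R) :=
  Quat t.1.1.1 t.1.1.2 t.1.2 t.2.
Lemma tuple_of_quatK : cancel tuple_of_quat quat_of_tuple.
Proof. by case. Qed.
HB.instance Definition _ := Choice.copy quat (can_type tuple_of_quatK).

Definition addq (p q : quat) : quat :=
  Quat (qre p + qre q) (qi p + qi q) (qj p + qj q) (qk p + qk q).
Definition oppq (q : quat) : quat :=
  Quat (- qre q) (- qi q) (- qj q) (- qk q).
Definition mulq (p q : quat) : quat :=
  Quat (qre p * qre q - qi p * qi q - qj p * qj q - qk p * qk q)
       (qre p * qi q + qi p * qre q + qj p * qk q - qk p * qj q)
       (qre p * qj q - qi p * qk q + qj p * qre q + qk p * qi q)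
       (qre p * qk q + qi p * qj q - qj p * qi q + qk p * qre q).

Definition quat_of_real (a : R) : quat := Quat a 0 0 0.

Lemma addqA : associative addq.
Proof. by move=> p q r; apply: quatP; rewrite /= addrA. Qed.
Lemma addqC : commutative addq.
Proof. by move=> p q; apply: quatP; rewrite /= addrC. Qed.
Lemma add0q : left_id (quat_of_real 0) addq.
Proof. by move=> p; apply: quatP; rewrite /= add0r. Qed.
Lemma addNq : left_inverse (quat_of_real 0) oppq addq.
Proof. by move=> p; apply: quatP; rewrite /= addNr. Qed.
HB.instance Definition _ :=
  GRing.isZmodule.Build quat addqA addqC add0q addNq.

Lemma mulqA : associative mulq.
Proof. by move=> p q r; apply: quatP => /=; ring. Qed.
Lemma mul1q : left_id (quat_of_real 1) mulq.
Proof. by move=> p; apply: quatP => /=; ring. Qed.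
Lemma mulq1 : right_id (quat_of_real 1) mulq.
Proof. by move=> p; apply: quatP => /=; ring. Qed.
Lemma mulqDl : left_distributive mulq addq.
Proof. by move=> p q r; apply: quatP => /=; ring. Qed.
Lemma mulqDr : right_distributive mulq addq.
Proof. by move=> p q r; apply: quatP => /=; ring. Qed.
Lemma oneq_neq0 : quat_of_real 1 != 0.
Proof. by apply/eqP => -[] /eqP; rewrite oner_eq0. Qed.
HB.instance Definition _ := GRing.Zmodule_isNzRing.Build quat
  mulqA mul1q mulq1 mulqDl mulqDr oneq_neq0.

Definition conjq (q : quat) : quat :=
  Quat (qre q) (- qi q) (- qj q) (- qk q).

Definition absq (q : quat) : R :=
  Num.sqrt (qre q ^+ 2 + qi q ^+ 2 + qj q ^+ 2 + qk q ^+ 2).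

(* The copy span_R {1, i} of the complex numbers inside the quaternions. *)
Definition complexes : set quat := [set q | qj q = 0 /\ qk q = 0].

Definition similarity_class (q : quat) : set quat :=
  [set conjq s * q * s | s in [set s | absq s = 1]].

Definition similarity_hull (A : set quat) : set quat :=
  \bigcup_(q in A) similarity_class q.

End QuatRing.

(* A right quaternionic Hilbert space is a real Banach space carrying a right
   quaternionic scalar multiplication that extends the real one, and a
   quaternion-valued inner product that induces the norm. Positive definiteness
   of the inner product is contained in [qinner_norm]. *)
HB.mixin Record CompleteNormedModule_isQuatHilbert (R : realType) H
    of CompleteNormedModule R H := {
  qscale : H -> quat R -> H;
  qinner : H -> H -> quat R;
  qscaleDl : forall (x y : H) (q : quat R),
    qscale (x + y) q = qscale x q + qscale y q;
  qscaleDr : forall (x : H) (p q : quat R),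
    qscale x (p + q) = qscale x p + qscale x q;
  qscaleA : forall (x : H) (p q : quat R),
    qscale (qscale x p) q = qscale x (p * q);
  qscale_real : forall (x : H) (a : R), qscale x (quat_of_real a) = a *: x;
  qinnerDl : forall x y z : H, qinner (x + y) z = qinner x z + qinner y z;
  qinnerZl : forall (x y : H) (q : quat R),
    qinner (qscale x q) y = qinner x y * q;
  qinnerC : forall x y : H, qinner x y = conjq (qinner y x);
  qinner_norm : forall x : H, qinner x x = quat_of_real (`|x| ^+ 2)
}.

#[short(type="quatHilbertType")]
HB.structure Definition QuatHilbert (R : realType) :=
  {H of CompleteNormedModule_isQuatHilbert R H & CompleteNormedModule R H}.

Section Operators.
Variables (R : realType) (H : quatHilbertType R).
Implicit Types (S : set (quat R)) (K : set H) (E : nat -> H) (T : H -> H).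

(* Bounded right S-linear operators K -> K, for a ring of scalars S and an
   S-subspace K of H; only the values of T on K matter. *)
Definition bounded_operator_on S K T : Prop :=
  [/\ forall x, K x -> K (T x),
      forall x y, K x -> K y -> T (x + y) = T x + T y,
      forall x q, K x -> S q -> T (qscale x q) = qscale (T x) q
    & exists M : R, forall x, K x -> `|T x| <= M * `|x|].

Definition invertible_on S K T : Prop :=
  bounded_operator_on S K T /\
  exists T' : H -> H, bounded_operator_on S K T' /\
    forall x, K x -> T' (T x) = x /\ T (T' x) = x.

Definition bounded_operator T : Prop :=
  bounded_operator_on [set: quat R] [set: H] T.

Definition Delta (q : quat R) T : H -> H :=
  fun x => T (T x) - (2 * qre q) *: T x + absq q ^+ 2 *: x.

Definition S_spectrum T : set (quat R) :=
  [set q | ~ invertible_on [set: quat R] [set: H] (Delta q T)].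

Definition span_over S E : set H :=
  [set x | exists n (c : nat -> quat R),
    (forall k, S (c k)) /\ x = \sum_(k < n) qscale (E k) (c k)].

Definition orthonormal_basis E : Prop :=
  (forall n m, qinner (E n) (E m) = (n == m)%:R) /\
  closure (span_over [set: quat R] E) = [set: H].

Definition complex_operator_wrt E T : Prop :=
  [/\ bounded_operator T, orthonormal_basis E
    & forall n m, complexes (qinner (T (E n)) (E m))].

Definition complex_part E : set H := closure (span_over (@complexes R) E).

Definition C_spectrum E T : set (quat R) :=
  [set l | complexes l /\
    ~ invertible_on (@complexes R) (complex_part E)
        (fun x => T x - qscale x l)].

End Operators.

(* Main.v *)
(* Write [K] for the closed complex span of the basis, so that [H = K + K j] is
   an orthogonal sum of real spaces. A quaternion-linear operator preserving [K]
   acts on [K j] as it does on [K], hence it is invertible on [H] iff it is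
   invertible on [K]. If [l] is complex with the real part and modulus of [q],
   then [Delta q T = Delta l T], which on [K] is the product of the commuting
   operators [T - l] and [T - conj l]; so [q] lies in the S-spectrum iff [l] or
   [conj l] lies in the C-spectrum. Finally [q] is similar to [l] exactly when
   the real parts and the moduli agree. *)
Require Import Defs.
From mathcomp Require Import all_boot all_order all_algebra.
From mathcomp Require Import all_classical all_reals all_analysis.
From mathcomp Require Import ring lra.

Set Implicit Arguments.
Unset Strict Implicit.
Unset Printing Implicit Defensive.

Import Order.TTheory GRing.Theory Num.Theory.
Import numFieldNormedType.Exports.

Local Open Scope classical_set_scope.
Local Open Scope ring_scope.

(** * Quaternion algebra and similarity classes *)

Section Quaternions.
Variable R : realType.
Implicit Types p q s l : quat R.

Lemma quatDE p q : p + q =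
  Quat (qre p + qre q) (qi p + qi q) (qj p + qj q) (qk p + qk q).
Proof. by []. Qed.

Lemma quatNE q : - q = Quat (- qre q) (- qi q) (- qj q) (- qk q).
Proof. by []. Qed.

Lemma quatME p q : p * q = Defs.mulq p q.
Proof. by []. Qed.

Lemma quat1E : 1 = Quat 1 0 0 0 :> quat R. Proof. by []. Qed.

Lemma quat0E : 0 = Quat 0 0 0 0 :> quat R. Proof. by []. Qed.

Definition quatE := (quatDE, quatNE, quatME, quat1E, quat0E).

Definition jq : quat R := Quat 0 0 1 0.

Lemma absq_jq : absq jq = 1.
Proof. by rewrite /absq /= expr1n expr0n /= !add0r addr0 sqrtr1. Qed.

Lemma conjqD p q : conjq (p + q) = conjq p + conjq q.
Proof. by rewrite !quatE; apply: quatP => //=; ring. Qed.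

Lemma conjqM p q : conjq (p * q) = conjq q * conjq p.
Proof. by rewrite !quatE; apply: quatP => /=; ring. Qed.

Lemma sqr_absq q :
  absq q ^+ 2 = qre q ^+ 2 + qi q ^+ 2 + qj q ^+ 2 + qk q ^+ 2.
Proof. by rewrite sqr_sqrtr// !addr_ge0 ?sqr_ge0. Qed.

Lemma absq_ge0 q : 0 <= absq q.
Proof. exact: sqrtr_ge0. Qed.

Lemma sqr_absq_mul p q : absq (p * q) ^+ 2 = absq p ^+ 2 * absq q ^+ 2.
Proof. by rewrite !sqr_absq !quatE /=; ring. Qed.

Lemma conjq_mul q : conjq q * q = quat_of_real (absq q ^+ 2).
Proof. by rewrite sqr_absq !quatE; apply: quatP => /=; ring. Qed.

Lemma quat_of_real_central (a : R) q : quat_of_real a * q = q * quat_of_real a.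
Proof. by rewrite !quatE; apply: quatP => /=; ring. Qed.

Lemma quat_split q :
  q = Quat (qre q) (qi q) 0 0 + Quat (qj q) (qk q) 0 0 * jq.
Proof. by rewrite !quatE; apply: quatP => /=; ring. Qed.

Lemma complexesD p q : complexes p -> complexes q -> complexes (p + q).
Proof. by move=> [p1 p2] [q1 q2]; split; rewrite /= ?p1 ?p2 ?q1 ?q2 addr0. Qed.

Lemma complexesN p : complexes p -> complexes (- p).
Proof. by move=> [p1 p2]; split; rewrite /= ?p1 ?p2 oppr0. Qed.

Lemma complexesM p q : complexes p -> complexes q -> complexes (p * q).
Proof.
by move=> [p1 p2] [q1 q2]; split; rewrite !quatE /= p1 p2 q1 q2; ring.
Qed.

Lemma complexes_conj p : complexes p -> complexes (conjq p).
Proof. by move=> [p1 p2]; split; rewrite /= ?p1 ?p2 oppr0. Qed.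

Lemma complexes_mulC p q : complexes p -> complexes q -> p * q = q * p.
Proof.
move=> [p1 p2] [q1 q2]; rewrite !quatE.
by apply: quatP; rewrite /= p1 p2 q1 q2; ring.
Qed.

Lemma similarity_class_invariants q p : similarity_class q p ->
  qre p = qre q /\ absq p = absq q.
Proof.
move=> [s /= s1 <-]; split; last first.
  apply/eqP; rewrite -(@eqrXn2 _ 2)// ?absq_ge0//.
  rewrite !sqr_absq_mul s1.
  have -> : absq (conjq s) = absq s by rewrite /absq /= !sqrrN.
  by rewrite s1 expr1n mulr1 mul1r.
have : absq s ^+ 2 = 1 by rewrite s1 expr1n.
rewrite sqr_absq => h; rewrite -[RHS]mul1r -h !quatE /=; ring.
Qed.

(** Normalizing [s] is enough: [conjq s * l * s = conjq s * s * q], and [conjq s * s] is the real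
    number [absq s ^+ 2]. Similarity thus becomes a linear equation in [s]. *)
Lemma similarity_class_intertwine l q s : s != 0 -> l * s = s * q ->
  similarity_class l q.
Proof.
move=> s0 lsq.
have as0 : absq s != 0.
  apply: contra_neq s0 => as0; have := sqr_absq s; rewrite as0 expr0n /=.
  move=> /esym/eqP; rewrite !paddr_eq0 ?addr_ge0 ?sqr_ge0// !sqrf_eq0.
  by move=> /andP[/andP[/andP[/eqP ? /eqP ?] /eqP ?] /eqP ?]; apply: quatP.
exists (s * quat_of_real (absq s)^-1) => /=.
  apply/eqP; rewrite -(@eqrXn2 _ 2)// ?absq_ge0// sqr_absq_mul expr1n.
  rewrite (sqr_absq (quat_of_real _)) /= !expr0n /= !addr0.
  by rewrite -exprMn mulfV// expr1n.
rewrite conjqM.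
set r := quat_of_real _.
have -> : conjq r = r by apply: quatP; rewrite //= oppr0.
rewrite -!mulrA (mulrA l) lsq -!mulrA (mulrA (conjq s)) conjq_mul.
rewrite -(quat_of_real_central _ q) !mulrA.
have -> : r * quat_of_real (absq s ^+ 2) * r = 1.
  by rewrite /r !quatE; apply: quatP => /=; field.
by rewrite mul1r.
Qed.

Lemma similarity_class_complex l q : complexes l -> qre q = qre l ->
  absq q = absq l -> similarity_class l q.
Proof.
case: l => a b ? ? [/= -> ->]; case: q => _ x y z /= ->.
move=> /(congr1 (fun t => t ^+ 2)).
rewrite !sqr_absq /= => h.
have {h} bxyz : b ^+ 2 = x ^+ 2 + y ^+ 2 + z ^+ 2 by nra.
have [b0|_] := eqVneq b 0.
  apply: (@similarity_class_intertwine _ _ 1); first exact: oner_neq0.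
  move: bxyz; rewrite b0 expr0n /= => /esym/eqP.
  rewrite !paddr_eq0 ?addr_ge0 ?sqr_ge0// !sqrf_eq0.
  by move=> /andP[/andP[/eqP-> /eqP->] /eqP->]; rewrite mul1r mulr1.
(* If [u] and [v] are pure with [u ^+ 2 = v ^+ 2], then [s := u * w + w * v]
   satisfies [u * s = s * v] for every [w]; here [w] is [1] or, up to a real
   factor, [j]. *)
have [s0|s0] := eqVneq (Quat 0 (b + x) y z) 0.
  apply: (@similarity_class_intertwine _ _ (Quat 0 0 0 1)).
    by apply/eqP => -[] /eqP; rewrite oner_eq0.
  case: s0 => bx -> ->; have {bx} -> : x = - b by lra.
  by rewrite !quatE; apply: quatP => /=; ring.
apply: similarity_class_intertwine s0 _.
rewrite !quatE; apply: quatP => /=; lra.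
Qed.

End Quaternions.

(** * Norm, continuity and spans in a right quaternionic Hilbert space *)

Section RightModule.
Variables (R : realType) (H : quatHilbertType R).
Implicit Types (x y z : H) (p q : quat R).

Lemma qscaleZl (a : R) x q : qscale (a *: x) q = a *: qscale x q.
Proof. by rewrite -!qscale_real !qscaleA quat_of_real_central. Qed.

Lemma qscale0l q : qscale (0 : H) q = 0.
Proof. by have := qscaleZl 0 0 q; rewrite !scale0r. Qed.

Lemma qscaleNl x q : qscale (- x) q = - qscale x q.
Proof. by rewrite -scaleN1r qscaleZl scaleN1r. Qed.

Lemma qscaleBl x y q : qscale (x - y) q = qscale x q - qscale y q.
Proof. by rewrite qscaleDl qscaleNl. Qed.

Lemma qscale0r x : qscale x 0 = 0.
Proof. by rewrite -(scale0r x) -qscale_real. Qed.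

Lemma qscale1r x : qscale x 1 = x.
Proof. by rewrite -[RHS]scale1r -qscale_real. Qed.

Lemma qscaleNr x q : qscale x (- q) = - qscale x q.
Proof.
have -> : - q = q * quat_of_real (-1).
  by rewrite !quatE; apply: quatP => /=; ring.
by rewrite -qscaleA qscale_real scaleN1r.
Qed.

Lemma qinnerDr x y z : qinner x (y + z) = qinner x y + qinner x z.
Proof. by rewrite qinnerC qinnerDl conjqD -!qinnerC. Qed.

Lemma qinnerZr x y q : qinner x (qscale y q) = conjq q * qinner x y.
Proof. by rewrite qinnerC qinnerZl conjqM -qinnerC. Qed.

Lemma qinner0l y : qinner (0 : H) y = 0.
Proof. by rewrite -(qscale0r 0) qinnerZl mulr0. Qed.

Lemma qinner_eq0 x : qinner x x = 0 -> x = 0.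
Proof.
by rewrite qinner_norm => -[] /eqP; rewrite expf_eq0 /= normr_eq0 => /eqP.
Qed.

Lemma normq_scale x q : `|qscale x q| = absq q * `|x|.
Proof.
apply/eqP; rewrite -(@eqrXn2 _ 2)// ?mulr_ge0 ?absq_ge0// exprMn.
have := congr1 (@qre R) (qinner_norm (qscale x q)).
rewrite qinnerZl qinnerZr qinner_norm -quat_of_real_central -mulrA conjq_mul.
by rewrite !quatE /= => <-; apply/eqP; ring.
Qed.

Lemma sqr_normD x y :
  `|x + y| ^+ 2 = `|x| ^+ 2 + `|y| ^+ 2 + 2 * qre (qinner x y).
Proof.
have := congr1 (@qre R) (qinner_norm (x + y)).
rewrite qinnerDl !qinnerDr !qinner_norm (qinnerC y x) /= => <-.
by ring.
Qed.

Lemma lipschitz_continuous (f : H -> H) (M : R) :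
  (forall x y, `|f x - f y| <= M * `|x - y|) -> continuous f.
Proof.
move=> fM x; apply/cvgrPdist_lt => e e0.
(* [M] may be zero or negative, so a positive Lipschitz constant is substituted before dividing by
   it. *)
have M1 : 0 < `|M| + 1 by rewrite ltr_wpDl.
near=> y; apply: (le_lt_trans (fM x y)).
apply: (@le_lt_trans _ _ ((`|M| + 1) * `|x - y|)).
  by rewrite ler_wpM2r// (le_trans (ler_norm M))// lerDl.
rewrite mulrC -ltr_pdivlMr//; near: y.
by apply: cvgr_dist_lt => //; rewrite divr_gt0.
Unshelve. all: by end_near. Qed.

Lemma continuous_qscale q : continuous (fun x : H => qscale x q).
Proof.
apply: (@lipschitz_continuous _ (absq q)) => x y.
by rewrite -qscaleBl normq_scale.
Qed.

(** By polarization the real part of the inner product is a polynomial in norms, and the norm is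
    continuous. *)
Lemma continuous_qre_qinner y : continuous (fun x : H => qre (qinner x y)).
Proof.
have -> : (fun x : H => qre (qinner x y)) =
    (fun x => (`|x + y| ^+ 2 - `|x| ^+ 2 - `|y| ^+ 2) / 2).
  by apply/funext => x; rewrite sqr_normD; field.
move=> x; apply: cvgM; last exact: cvg_cst.
apply: cvgB; last exact: cvg_cst.
apply: cvgB; rewrite expr2; apply: cvgM; apply: cvg_norm => //;
  by apply: cvgD => //; exact: cvg_cst.
Qed.

(** Taking [q] among the units 1, i, j, k isolates, up to sign, each coordinate of the inner
    product; every closedness fact about [qinner] reduces to this one. *)
Lemma closed_qre_qinner0 q y : closed [set x : H | qre (qinner x y * q) = 0].
Proof.
rewrite (_ : mkset _ =
  (fun x : H => qre (qinner (qscale x q) y)) @^-1` [set r | r = 0]); last first.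
  by apply/seteqP; split => x /=; rewrite qinnerZl.
apply: preimage_closed; last exact: closed_eq.
move=> x _; apply: (continuous_comp (@continuous_qscale q x)
  (@continuous_qre_qinner y _)).
Qed.

Lemma closed_qinner_complexes y : closed [set x : H | complexes (qinner x y)].
Proof.
rewrite (_ : mkset _ = [set x | qre (qinner x y * Quat 0 0 1 0) = 0] `&`
    [set x | qre (qinner x y * Quat 0 0 0 1) = 0]); last first.
  by apply/seteqP; split => x /= [h1 h2]; split => /=; lra.
by apply: closedI; exact: closed_qre_qinner0.
Qed.

Lemma closed_qinner0 y : closed [set x : H | qinner x y = 0].
Proof.
rewrite (_ : mkset _ = ([set x | qre (qinner x y * 1) = 0] `&`
    [set x | qre (qinner x y * Quat 0 1 0 0) = 0]) `&`
    ([set x | qre (qinner x y * Quat 0 0 1 0) = 0] `&`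
    [set x | qre (qinner x y * Quat 0 0 0 1) = 0])); last first.
  apply/seteqP; split => x /=.
    by move=> ->; rewrite !quatE /=; do !split => //; ring.
  by move=> /= [[h0 h1] [h2 h3]]; apply: quatP => /=; lra.
by do !apply: closedI; exact: closed_qre_qinner0.
Qed.

Lemma span_over_ind (S : set (quat R)) (E : nat -> H) (P : set H) :
  P 0 -> (forall x y, P x -> P y -> P (x + y)) ->
  (forall k c, S c -> P (qscale (E k) c)) -> span_over S E `<=` P.
Proof.
move=> P0 PD PE _ [n [c [Sc ->]]].
by apply: (big_ind P) => // k _; exact: PE.
Qed.

Lemma span_over_mem (S : set (quat R)) (E : nat -> H) k c :
  S 0 -> S c -> span_over S E (qscale (E k) c).
Proof.
move=> S0 Sc; exists k.+1, (fun i => if i == k then c else 0).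
split => [i|]; first by case: ifP.
rewrite (bigD1 ord_max) //= eqxx big1 ?addr0// => i /negPf.
by rewrite -val_eqE /= => ->; rewrite qscale0r.
Qed.

Lemma span_overD (S : set (quat R)) (E : nat -> H) x y :
  S 0 -> (forall p q, S p -> S q -> S (p + q)) ->
  span_over S E x -> span_over S E y -> span_over S E (x + y).
Proof.
move=> S0 SD [n [c [Sc ->]]] [m [d [Sd ->]]].
exists (maxn n m), (fun k => (if (k < n)%N then c k else 0) +
  (if (k < m)%N then d k else 0)).
split => [k|]; first by apply: SD; case: ifP.
rewrite (big_ord_widen _ (fun k => qscale (E k) (c k)) (leq_maxl n m)).
rewrite (big_ord_widen _ (fun k => qscale (E k) (d k)) (leq_maxr n m)).
rewrite [X in X + _]big_mkcond [X in _ + X]big_mkcond -big_split /=.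
apply: eq_bigr => k _; rewrite qscaleDr.
by case: ifP; case: ifP; rewrite ?qscale0r.
Qed.

Lemma closure_sub (A B : set H) : closed B -> A `<=` B -> closure A `<=` B.
Proof. by move=> cB AB; rewrite closureE; apply: smallest_sub. Qed.

End RightModule.

(** * The orthogonal real decomposition [H = K + K j] *)

Section ComplexPart.
Variables (R : realType) (H : quatHilbertType R) (E : nat -> H).
Hypothesis E_basis : orthonormal_basis E.
Implicit Types (x y u v : H) (p q l : quat R).
Local Notation K := (complex_part E).
Local Notation j := (jq R).

Lemma complex_part_closed : closed K.
Proof. exact: closed_closure. Qed.

Lemma complex_part_ind (P : set H) : closed P ->
  P 0 -> (forall x y, P x -> P y -> P (x + y)) ->
  (forall k l, complexes l -> P (qscale (E k) l)) -> K `<=` P.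
Proof.
by move=> cP P0 PD PE; apply: closure_sub => //; exact: span_over_ind.
Qed.

Lemma basis_ind (P : set H) : closed P ->
  P 0 -> (forall x y, P x -> P y -> P (x + y)) ->
  (forall k q, P (qscale (E k) q)) -> forall x, P x.
Proof.
move=> cP P0 PD PE x; have : [set: H] x by [].
rewrite -E_basis.2; apply: closure_sub => // {}x.
by apply: span_over_ind => // k c _; exact: PE.
Qed.

Lemma complex_partE k l : complexes l -> K (qscale (E k) l).
Proof. by move=> Cl; apply: subset_closure; apply: span_over_mem. Qed.

Lemma complex_part0 : K 0.
Proof. by rewrite -(qscale0r (E 0)); exact: complex_partE. Qed.

(** Density is used in one summand at a time: translations are continuous, so for a fixed summand
    the condition on the other is closed. *)
Lemma complex_partD x y : K x -> K y -> K (x + y).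
Proof.
have closed_shift z : closed [set w | K (w + z)].
  apply: (@preimage_closed _ _ (fun w => w + z) K) complex_part_closed.
  by move=> w _; apply: cvgD => //; exact: cvg_cst.
move=> + Ky; move: y Ky x.
apply: (@complex_part_ind [set y | forall x, K x -> K (x + y)]) => /=.
- rewrite (_ : mkset _ = \bigcap_(x in K) [set y | K (y + x)]); last first.
    by apply/seteqP; split => y /= h x Kx /=; rewrite addrC; exact: h.
  by apply: closed_bigI => x _; exact: closed_shift.
- by move=> x; rewrite addr0.
- by move=> y z hy hz x Kx; rewrite addrA; apply: hz; exact: hy.
move=> k l Cl; apply: closure_sub (closed_shift _) _ => w Kw.
apply: subset_closure; apply: span_overD => //; first exact: complexesD.
exact: span_over_mem.
Qed.

Lemma complex_part_scale x l : complexes l -> K x -> K (qscale x l).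
Proof.
move=> Cl; apply: (@complex_part_ind [set x | K (qscale x l)]) => /=.
- apply: (@preimage_closed _ _ (fun x => qscale x l) K) complex_part_closed.
  by move=> z _; exact: continuous_qscale.
- by rewrite qscale0l; exact: complex_part0.
- by move=> y z Ky Kz; rewrite qscaleDl; exact: complex_partD.
- by move=> k p Cp; rewrite qscaleA; apply: complex_partE; exact: complexesM.
Qed.

Lemma complex_part_scaler x (a : R) : K x -> K (a *: x).
Proof. by move=> Kx; rewrite -qscale_real; exact: complex_part_scale. Qed.

Lemma complex_partB x y : K x -> K y -> K (x - y).
Proof.
move=> Kx Ky; apply: complex_partD => //.
by rewrite -scaleN1r; exact: complex_part_scaler.
Qed.

Lemma complexes_conjE p : complexes (conjq p) -> complexes p.
Proof. by move=> [/= h1 h2]; split; lra. Qed.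

Lemma qinner_complex_part u v : K u -> K v -> complexes (qinner u v).
Proof.
move=> Ku Kv; move: u Ku.
apply: (@complex_part_ind [set u | complexes (qinner u v)]) => /=.
- exact: closed_qinner_complexes.
- by rewrite qinner0l.
- by move=> x y Cx Cy; rewrite qinnerDl; exact: complexesD.
move=> k l Cl; rewrite qinnerZl; apply: complexesM => //.
(* Conjugate symmetry brings [v] into the first slot, where the closedness and linearity facts
   apply. *)
apply: complexes_conjE; rewrite -qinnerC; move: v Kv.
apply: (@complex_part_ind [set v | complexes (qinner v (E k))]) => /=.
- exact: closed_qinner_complexes.
- by rewrite qinner0l.
- by move=> x y Cx Cy; rewrite qinnerDl; exact: complexesD.
move=> m p Cp; rewrite qinnerZl E_basis.1; apply: complexesM => //.
by case: eqP.
Qed.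

(** Pythagoras: [qinner u v] is complex, so [qinner u (qscale v j)] has only j and k coordinates and
    its real part vanishes. *)
Lemma sqr_norm_complex_sum u v : K u -> K v ->
  `|u + qscale v j| ^+ 2 = `|u| ^+ 2 + `|v| ^+ 2.
Proof.
move=> Ku Kv; have [c1 c2] := qinner_complex_part Ku Kv.
rewrite sqr_normD qinnerZr normq_scale.
by rewrite absq_jq mul1r !quatE /= c1 c2; ring.
Qed.

(** The two component maps are nonexpansive. This yields uniqueness of the decomposition, closedness
    of [K + K j], and bounds for operators defined componentwise. *)
Lemma norm_complex_sum_ge u v : K u -> K v ->
  `|u| <= `|u + qscale v j| /\ `|v| <= `|u + qscale v j|.
Proof.
move=> Ku Kv; split; rewrite -ler_sqr ?nnegrE// sqr_norm_complex_sum//.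
  by rewrite lerDl sqr_ge0.
by rewrite lerDr sqr_ge0.
Qed.

Lemma complex_sumB u v u' v' : (u + qscale v j) - (u' + qscale v' j) =
  (u - u') + qscale (v - v') j.
Proof. by rewrite qscaleBl opprD addrACA. Qed.

Lemma complex_sum_inj u v u' v' : K u -> K v -> K u' -> K v' ->
  u + qscale v j = u' + qscale v' j -> u = u' /\ v = v'.
Proof.
move=> Ku Kv Ku' Kv' uv.
have [] := norm_complex_sum_ge (complex_partB Ku Ku') (complex_partB Kv Kv').
rewrite -complex_sumB uv subrr normr0 !normr_le0 !subr_eq0.
by move=> /eqP-> /eqP->.
Qed.

Definition complex_sum : set H :=
  [set x | exists uv : H * H, [/\ K uv.1, K uv.2 & x = uv.1 + qscale uv.2 j]].

(** The image of a Cauchy filter under a nonexpansive map is Cauchy, and [H] is complete. The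
    estimate is only available on [A], so Cauchy neighbourhoods are intersected with [A]. *)
Lemma nonexpansive_cvg (G : set_system H) (A : set H) (f : H -> H) x :
  ProperFilter G -> G --> x -> G A ->
  (forall y z, A y -> A z -> `|f y - f z| <= `|y - z|) -> cvg (f @ G).
Proof.
move=> PG Gx GA fA; apply: cauchy_cvg; apply/cauchy_ballP => e e0.
have /cauchy_ballP/(_ e e0) : cauchy G.
  by apply: cvg_cauchy; apply/cvg_ex; exists x.
move=> -[[P Q] /= [GP GQ] PQ]; rewrite near_map2.
exists (P `&` A, Q `&` A) => /=.
  by split; [exact: (filterI GP GA)|exact: (filterI GQ GA)].
move=> [y z] /= [[Py Ay] [Qz Az]]; have := PQ (y, z) (conj Py Qz).
by rewrite -ball_normE /=; apply: le_lt_trans; exact: fA.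
Qed.

(** Along a filter converging in [H], the components converge as well, and their limits stay in the
    closed set [K]. *)
Lemma closed_complex_sum : closed complex_sum.
Proof.
suff h : closure complex_sum `<=` complex_sum.
  by apply/closure_id/seteqP; split => //; exact: subset_closure.
move=> x; rewrite closureEcvg => -[G PG [Gx GA]].
have {}GA : G complex_sum by apply: GA => y.
(* [f] selects the components of each point of [complex_sum]; nothing is required of its values
   elsewhere. *)
have /choice[f fP] : forall y, exists uv : H * H,
    complex_sum y -> [/\ K uv.1, K uv.2 & y = uv.1 + qscale uv.2 j].
  move=> y; have [[uv h]|h] := pselect (complex_sum y); first by exists uv.
  by exists 0.
have f_nonexp y z : complex_sum y -> complex_sum z ->
    `|(f y).1 - (f z).1| <= `|y - z| /\ `|(f y).2 - (f z).2| <= `|y - z|.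
  move=> /fP[K1 K2 yE] /fP[K3 K4 zE].
  rewrite {2 4}yE {2 4}zE complex_sumB.
  by apply: norm_complex_sum_ge; exact: complex_partB.
have /cvg_ex[u fu] : cvg ((fun y => (f y).1) @ G).
  apply: nonexpansive_cvg Gx GA _ => y z Ay Az.
  by have [] := f_nonexp _ _ Ay Az.
have /cvg_ex[v fv] : cvg ((fun y => (f y).2) @ G).
  apply: nonexpansive_cvg Gx GA _ => y z Ay Az.
  by have [] := f_nonexp _ _ Ay Az.
exists (u, v); split => /=.
- apply: (closed_cvg K complex_part_closed _ _ fu).
  by apply: filterS GA => y /fP[].
- apply: (closed_cvg K complex_part_closed _ _ fv).
  by apply: filterS GA => y /fP[].
have fuv : (fun y => (f y).1 + qscale (f y).2 j) @ G --> u + qscale v j.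
  by apply: cvgD fu _; exact: (cvg_comp _ _ fv (@continuous_qscale _ _ j v)).
apply: (@norm_cvg_unique _ _ _ _ _ _ Gx).
apply: cvg_trans fuv; apply: near_eq_cvg.
by apply: filterS GA => y /fP[_ _ /esym].
Qed.

(** A quaternion is [z + w * j] with [z] and [w] complex, so the closed set [complex_sum] contains
    all quaternionic multiples of the basis vectors, whose span is dense. *)
Lemma complex_sum_full x : complex_sum x.
Proof.
move: x; apply: basis_ind.
- exact: closed_complex_sum.
- by exists 0; split; rewrite /= ?qscale0l ?addr0//; exact: complex_part0.
- move=> _ _ [[u v] /= [Ku Kv ->]] [[u' v'] /= [Ku' Kv' ->]].
  exists (u + u', v + v') => /=; split; try exact: complex_partD.
  by rewrite qscaleDl addrACA.
move=> k q; exists (qscale (E k) (Quat (qre q) (qi q) 0 0),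
  qscale (E k) (Quat (qj q) (qk q) 0 0)); split; try exact: complex_partE.
by rewrite /= qscaleA -qscaleDr -quat_split.
Qed.

Lemma bounded_operator_continuous (A : H -> H) :
  bounded_operator A -> continuous A.
Proof.
move=> [_ AD AZ [M AM]]; apply: (@lipschitz_continuous _ _ _ M) => x y.
rewrite (_ : A x - A y = A (x - y)) ?AM//.
by rewrite AD// -(scaleN1r y) -qscale_real AZ// qscale_real scaleN1r.
Qed.

(** The vectors orthogonal to [v] form a closed set containing the span of the basis, hence [v]
    itself. *)
Lemma basis_orthogonal v : (forall n, qinner v (E n) = 0) -> v = 0.
Proof.
move=> vE; apply: qinner_eq0.
apply: (@basis_ind [set x | qinner x v = 0]) => /=.
- exact: closed_qinner0.
- by rewrite qinner0l.
- by move=> x y; rewrite qinnerDl => -> ->; rewrite addr0.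
move=> k q; rewrite qinnerZl qinnerC vE !quatE; apply: quatP => /=; ring.
Qed.

Lemma complex_part_stable T : complex_operator_wrt E T ->
  forall x, K x -> K (T x).
Proof.
move=> [bT _ CT]; have [_ TD TZ _] := bT.
have T0 : T 0 = 0 by have := TZ 0 0 I I; rewrite !qscale0r.
have KTE n : K (T (E n)).
  have [[u v] /= [Ku Kv TE]] := complex_sum_full (T (E n)).
  suff -> : T (E n) = u by [].
  (* The coefficient of [T (E n)] at [E m] is [qinner u (E m) + qinner v (E m) * j] with both inner
     products complex; being complex itself, it forces [qinner v (E m) = 0]. *)
  suff v0 : v = 0 by rewrite TE v0 qscale0l addr0.
  apply: basis_orthogonal => m; have := CT n m.
  rewrite TE qinnerDl qinnerZl.
  have KE : K (E m) by rewrite -(qscale1r (E m)); apply: complex_partE.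
  have [u1 u2] := qinner_complex_part Ku KE.
  have [v1 v2] := qinner_complex_part Kv KE.
  rewrite !quatE => -[/= h1 h2]; apply: quatP => /=; lra.
apply: complex_part_ind.
- apply: (@preimage_closed _ _ T K) complex_part_closed.
  by move=> x _; exact: bounded_operator_continuous.
- by rewrite T0; exact: complex_part0.
- by move=> x y Kx Ky; rewrite TD//; exact: complex_partD.
by move=> k l Cl; rewrite TZ//; exact: complex_part_scale.
Qed.

End ComplexPart.

(** * Algebra of bounded and invertible operators on a subspace *)

Section BoundedOperators.
Variables (R : realType) (H : quatHilbertType R).
Variables (S : set (quat R)) (K : set H).
Implicit Types A B : H -> H.

Lemma bounded_operator_on_ge0 A : bounded_operator_on S K A ->
  exists2 M : R, 0 <= M & forall x, K x -> `|A x| <= M * `|x|.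
Proof.
move=> [_ _ _ [M AM]]; exists `|M| => // x Kx.
by rewrite (le_trans (AM x Kx))// ler_wpM2r// ler_norm.
Qed.

Lemma bounded_operator_onD A B :
  (forall x y, K x -> K y -> K (x + y)) ->
  bounded_operator_on S K A -> bounded_operator_on S K B ->
  bounded_operator_on S K (fun x => A x + B x).
Proof.
move=> KD [KA AD AZ [M AM]] [KB BD BZ [N BN]].
split => [x Kx|x y Kx Ky|x q Kx Sq|].
- by apply: KD; [exact: KA|exact: KB].
- by rewrite AD// BD// addrACA.
- by rewrite AZ// BZ// qscaleDl.
exists (M + N) => x Kx; rewrite mulrDl (le_trans (ler_normD _ _))// lerD//.
  exact: AM.
exact: BN.
Qed.

Lemma bounded_operator_onZ (a : R) A : (forall x, K x -> K (a *: x)) ->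
  bounded_operator_on S K A -> bounded_operator_on S K (fun x => a *: A x).
Proof.
move=> KZ [KA AD AZ [M AM]]; split => [x Kx|x y Kx Ky|x q Kx Sq|].
- by apply: KZ; exact: KA.
- by rewrite AD// scalerDr.
- by rewrite AZ// qscaleZl.
by exists (`|a| * M) => x Kx; rewrite normrZ -mulrA ler_wpM2l// AM.
Qed.

Lemma bounded_operator_on_comp A B :
  bounded_operator_on S K A -> bounded_operator_on S K B ->
  bounded_operator_on S K (A \o B).
Proof.
move=> bA [KB BD BZ [N BN]]; have [M M0 AM] := bounded_operator_on_ge0 bA.
have [KA AD AZ _] := bA.
split => [x Kx|x y Kx Ky|x q Kx Sq|] /=.
- by apply: KA; exact: KB.
- by rewrite BD// AD//; exact: KB.
- by rewrite BZ// AZ//; exact: KB.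
exists (M * N) => x Kx; rewrite (le_trans (AM _ (KB _ Kx)))//.
by rewrite -mulrA ler_wpM2l// BN.
Qed.

Lemma eq_bounded_operator_on A B : (forall x, K x -> A x = B x) ->
  (forall x y, K x -> K y -> K (x + y)) ->
  (forall x q, K x -> S q -> K (qscale x q)) ->
  bounded_operator_on S K A -> bounded_operator_on S K B.
Proof.
move=> AB KD KZ [KA AD AZ [M AM]]; split => [x Kx|x y Kx Ky|x q Kx Sq|].
- by rewrite -AB//; exact: KA.
- by rewrite -!AB ?AD//; exact: KD.
- by rewrite -!AB ?AZ//; exact: KZ.
by exists M => x Kx; rewrite -AB// AM.
Qed.

Lemma eq_invertible_on A B : (forall x, K x -> A x = B x) ->
  (forall x y, K x -> K y -> K (x + y)) ->
  (forall x q, K x -> S q -> K (qscale x q)) ->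
  invertible_on S K A -> invertible_on S K B.
Proof.
move=> AB KD KZ [bA [A' [bA' AA']]]; split.
  exact: eq_bounded_operator_on bA.
exists A'; split => // x Kx; have [KA' _ _ _] := bA'.
by rewrite -!AB//; [exact: AA'|exact: KA'].
Qed.

Lemma invertible_on_comp A B :
  invertible_on S K A -> invertible_on S K B -> invertible_on S K (A \o B).
Proof.
move=> [bA [A' [bA' AA']]] [bB [B' [bB' BB']]].
split; first exact: bounded_operator_on_comp.
exists (B' \o A'); split; first exact: bounded_operator_on_comp.
have [KB _ _ _] := bB; have [KA' _ _ _] := bA'.
move=> x Kx /=; rewrite (AA' _ (KB _ Kx)).1 (BB' _ Kx).1.
by rewrite (BB' _ (KA' _ Kx)).2 (AA' _ Kx).2.
Qed.

(** With [D] the inverse of the product, [B \o D] is a right inverse of [A]; it is also a left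
    inverse because [A] commutes with [A \o B], hence with [D]. *)
Lemma invertible_on_compl A B :
  bounded_operator_on S K A -> bounded_operator_on S K B ->
  (forall x, K x -> A (B x) = B (A x)) ->
  invertible_on S K (A \o B) -> invertible_on S K A.
Proof.
move=> bA bB AB [_ [D [bD DAB]]]; split => //.
have [KA _ _ _] := bA; have [KB _ _ _] := bB; have [KD _ _ _] := bD.
exists (B \o D); split; first exact: bounded_operator_on_comp.
move=> x Kx /=; split; last exact: (DAB x Kx).2.
have DA : D (A x) = A (D x).
  have KDx : K (D x) by exact: KD.
  have -> : A x = A (B (A (D x))) by rewrite -AB// -[in LHS](DAB x Kx).2.
  exact: (DAB _ (KA _ KDx)).1.
rewrite DA -AB; last exact: KD.
exact: (DAB x Kx).2.
Qed.

End BoundedOperators.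

(** * Passing invertibility between [H] and [K], and factoring [Delta] *)

Section ComplexOperator.
Variables (R : realType) (H : quatHilbertType R) (E : nat -> H) (T : H -> H).
Hypothesis T_complex : complex_operator_wrt E T.
Implicit Types (x y u v : H) (p q l : quat R) (A : H -> H).
Local Notation K := (complex_part E).
Local Notation j := (jq R).
Local Notation C := (@complexes R).

Let E_basis : orthonormal_basis E. Proof. by case: T_complex. Qed.
Let T_bounded : bounded_operator T. Proof. by case: T_complex. Qed.

Lemma bounded_operator_restrict A : bounded_operator A ->
  (forall x, K x -> K (A x)) -> bounded_operator_on C K A.
Proof.
move=> [_ AD AZ [M AM]] KA; split=> // [x y _ _|x q _ _|].
- exact: AD.
- exact: AZ.
by exists M => x _; exact: AM.
Qed.

(** Moving [j] past a complex number conjugates it, whence the signs on [qi q] and [qk q]; the minus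
    between the first two terms is [j * j = -1]. *)
Lemma qscale_sum u v q : qscale (u + qscale v j) q =
  (qscale u (Quat (qre q) (qi q) 0 0) - qscale v (Quat (qj q) (- qk q) 0 0)) +
  qscale (qscale u (Quat (qj q) (qk q) 0 0)
    + qscale v (Quat (qre q) (- qi q) 0 0)) j.
Proof.
rewrite !qscaleDl !qscaleA -qscaleNr.
rewrite addrACA -!qscaleDr; congr (qscale _ _ + qscale _ _);
  by rewrite !quatE; apply: quatP => /=; ring.
Qed.

Lemma invertible_on_complex_part A : bounded_operator A ->
  (forall x, K x -> K (A x)) ->
  invertible_on [set: quat R] [set: H] A <-> invertible_on C K A.
Proof.
move=> bA KA; have [_ AD AZ _] := bA; split.
  move=> [_ [B [bB BA]]]; split; first exact: bounded_operator_restrict.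
  exists B; split; last by move=> x _; exact: BA.
  apply: bounded_operator_restrict => // x Kx.
  (* The inverse preserves [K]: applying [A] to [B x = u + v j] gives [x], which has no [K j]
     component, so [A v = 0] and [v = 0] by injectivity. *)
  have [[u v] /= [Ku Kv Bx]] := complex_sum_full E_basis (B x).
  have := (BA x I).2; rewrite Bx AD// AZ// => ABx.
  have : A u + qscale (A v) j = x + qscale 0 j by rewrite qscale0l addr0.
  move=> /(complex_sum_inj E_basis (KA _ Ku) (KA _ Kv) Kx (complex_part0 E)).
  move=> [_ Av0]; suff -> : v = 0 by rewrite qscale0l addr0.
  have [_ _ BZ _] := bB; rewrite -(BA v I).1 Av0.
  by have := BZ 0 0 I I; rewrite !qscale0r.
move=> [_ [B [bB BA]]]; split => //.
have [KB BD BZ _] := bB; have [M M0 BM] := bounded_operator_on_ge0 bB.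
have /choice[f fP] := complex_sum_full E_basis.
(* The inverse on [K] is extended componentwise. Uniqueness of components makes [B'] computable on
   any decomposition, whichever one [f] chose. *)
pose B' x := B (f x).1 + qscale (B (f x).2) j.
have B'E u v : K u -> K v -> B' (u + qscale v j) = B u + qscale (B v) j.
  move=> Ku Kv; have [Kf1 Kf2] := fP (u + qscale v j).
  move=> /(complex_sum_inj E_basis Ku Kv Kf1 Kf2)[uE vE].
  by rewrite /B' -uE -vE.
exists B'; split; last first.
  move=> x _; have [Ku Kv xE] := fP x.
  rewrite xE AD// AZ// !B'E//; try exact: KA.
  rewrite AD// AZ// !(BA _ Ku).1 !(BA _ Kv).1.
  by rewrite !(BA _ Ku).2 !(BA _ Kv).2.
split => // [x y _ _|x q _ _|].
- have [Ku Kv ->] := fP x; have [Ku' Kv' ->] := fP y.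
  rewrite addrACA -qscaleDl !B'E//; try exact: complex_partD.
  by rewrite !BD// qscaleDl addrACA.
- have [Ku Kv ->] := fP x.
  have KZ z a b : K z -> K (qscale z (Quat a b 0 0)).
    by move=> Kz; apply: complex_part_scale.
  rewrite qscale_sum !B'E//; last first.
  - by apply: complex_partD; exact: KZ.
  - by apply: complex_partB; exact: KZ.
  rewrite -qscaleNr qscale_sum -qscaleNr.
  have NC a b : C (- Quat a b 0 0) by exact: complexesN.
  rewrite !BD ?BZ//; try exact: KZ.
  exact: complex_part_scale.
(* One [M] for each component, as neither component exceeds [x] in norm and [j] has modulus 1. *)
exists (M + M) => x _; rewrite (le_trans (ler_normD _ _))// mulrDl.
have [Ku Kv xE] := fP x.
have [ux vx] := norm_complex_sum_ge E_basis Ku Kv; rewrite -xE in ux vx.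
rewrite lerD//; first by rewrite (le_trans (BM _ Ku))// ler_wpM2l.
rewrite normq_scale absq_jq mul1r.
by rewrite (le_trans (BM _ Kv))// ler_wpM2l.
Qed.

Lemma Delta_bounded q : bounded_operator (Delta q T).
Proof.
have -> : Delta q T = fun x =>
    (T (T x) + (- (2 * qre q)) *: T x) + absq q ^+ 2 *: x.
  by apply/funext => x; rewrite /Delta scaleNr.
apply: bounded_operator_onD => //.
  apply: bounded_operator_onD => //.
    exact: (bounded_operator_on_comp T_bounded T_bounded).
  exact: bounded_operator_onZ.
apply: (@bounded_operator_onZ _ _ _ _ _ id) => //.
by split => //; exists 1 => x _; rewrite mul1r.
Qed.

Lemma Delta_complex_part q x : K x -> K (Delta q T x).
Proof.
have KT := complex_part_stable E_basis T_complex.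
move=> Kx; apply: complex_partD; last exact: complex_part_scaler.
apply: complex_partB; first exact/KT/KT.
by apply: complex_part_scaler; exact: KT.
Qed.

(** Right multiplication by [l] respects complex scalars because these commute with [l]. *)
Lemma shift_bounded l : complexes l ->
  bounded_operator_on C K (fun x => T x - qscale x l).
Proof.
move=> Cl.
have -> : (fun x => T x - qscale x l) = (fun x => T x + qscale x (- l)).
  by apply/funext => x; rewrite qscaleNr.
apply: bounded_operator_onD; first exact: complex_partD.
  exact: bounded_operator_restrict (complex_part_stable E_basis T_complex).
have CN := complexesN Cl; split => [x Kx|x y _ _|x q _ Cq|].
- exact: complex_part_scale.
- by rewrite qscaleDl.
- by rewrite !qscaleA; congr qscale; exact: complexes_mulC.
by exists (absq (- l)) => x _; rewrite normq_scale.
Qed.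

(** The coefficients match since [l + conjq l] is twice the real part of [l] and [conjq l * l] is
    its squared modulus. *)
Lemma Delta_factor l x : complexes l -> Delta l T x =
  T (T x - qscale x (conjq l)) - qscale (T x - qscale x (conjq l)) l.
Proof.
move=> Cl; have [_ TD TZ _] := T_bounded.
rewrite /Delta -(qscaleNr _ (conjq l)) TD// TZ// qscaleDl !qscaleA opprD !addrA.
rewrite -(qscaleNr (T x)) -!qscale_real -(qscaleNr (T x)) -qscaleNr -!addrA.
congr (_ + _); rewrite !addrA -qscaleDr; congr (qscale _ _ + qscale _ _).
  by case: Cl => h1 h2; rewrite !quatE; apply: quatP => /=; lra.
rewrite sqr_absq; case: Cl => h1 h2; rewrite !quatE.
by apply: quatP => /=; rewrite h1 h2; ring.
Qed.

Lemma Delta_invertible l : complexes l ->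
  invertible_on [set: quat R] [set: H] (Delta l T) <->
  invertible_on C K (fun x => T x - qscale x l) /\
  invertible_on C K (fun x => T x - qscale x (conjq l)).
Proof.
move=> Cl; have Cl' := complexes_conj Cl.
have lK : conjq (conjq l) = l by apply: quatP; rewrite //= opprK.
have DE : Delta (conjq l) T = Delta l T by rewrite /Delta /absq /= !sqrrN.
rewrite invertible_on_complex_part;
  [|exact: Delta_bounded|exact: Delta_complex_part].
have KD := @complex_partD _ _ E.
have KZ x q : K x -> C q -> K (qscale x q).
  by move=> *; exact: complex_part_scale.
have comm p q x : complexes p -> conjq p = q ->
    ((fun x => T x - qscale x p) \o (fun x => T x - qscale x q)) x =
    Delta p T x.
  by move=> Cp <-; rewrite Delta_factor.
(* Both orders of the factors equal [Delta l T], because [l] and [conjq l] define the same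
   [Delta]. *)
have commute x : K x ->
    T (T x - qscale x (conjq l)) - qscale (T x - qscale x (conjq l)) l =
    T (T x - qscale x l) - qscale (T x - qscale x l) (conjq l).
  move=> _; have := comm l _ x Cl erefl; have := comm _ _ x Cl' lK.
  by rewrite DE => /= -> ->.
split => [iD|[i1 i2]]; last first.
  apply: eq_invertible_on (invertible_on_comp i1 i2) => // x _.
  exact: comm.
split.
  apply: (invertible_on_compl (shift_bounded Cl) (shift_bounded Cl')).
    exact: commute.
  by apply: eq_invertible_on iD => // x _; rewrite comm.
apply: (invertible_on_compl (shift_bounded Cl') (shift_bounded Cl)).
  by move=> x Kx; rewrite commute.
by apply: eq_invertible_on iD => // x _; rewrite comm// DE.
Qed.

End ComplexOperator.

(** * Comparison of the two spectra *)

Theorem proposition2p6 (R : realType) (H : quatHilbertType R)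
    (H_separable : exists2 D : set H, countable D & dense D)
    (E : nat -> H) (T : H -> H) (T_complex : complex_operator_wrt E T) :
  S_spectrum T = similarity_hull (C_spectrum E T).
Proof.
apply/seteqP; split => q.
  have l_ge0 : 0 <= qi q ^+ 2 + qj q ^+ 2 + qk q ^+ 2.
    by rewrite !addr_ge0 ?sqr_ge0.
  (* [l] is the complex number with nonnegative imaginary part that shares the real part and modulus
     of [q]. *)
  pose l := Quat (qre q) (Num.sqrt (qi q ^+ 2 + qj q ^+ 2 + qk q ^+ 2)) 0 0.
  have Cl : complexes l by [].
  have absql : absq q = absq l.
    by rewrite {2}/absq /= sqr_sqrtr// !expr0n /= !addr0 /absq !addrA.
  have DE : Delta q T = Delta l T by rewrite /Delta absql.
  (* At least one of the two shifts, by [l] or by [conjq l], fails to be invertible; [q] is similar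
     to both numbers, so either can be the witness. *)
  rewrite /S_spectrum /= DE (Delta_invertible T_complex Cl) => /not_andP[nl|nl].
    by exists l => //; exact: similarity_class_complex.
  exists (conjq l); first by split => //; exact: complexes_conj.
  apply: similarity_class_complex => //; first exact: complexes_conj.
  by rewrite absql /absq /= !sqrrN.
move=> [l [Cl nl] /similarity_class_invariants[reE absE]].
rewrite /S_spectrum /=.
have -> : Delta q T = Delta l T by rewrite /Delta reE absE.
by rewrite (Delta_invertible T_complex Cl) => -[/nl].
Qed.
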